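(* Let $(P,Q)$ be a quasi-projection pair on a Hilbert $C^*$-module $\mathscr{H}$. If one of the four pairs $$(P,Q),\quad (I-P,I-Q),\quad (P,Q^* ),\quad (I-P,I-Q^* )$$ is semi-harmonious, then the remaining three pairs are all semi-harmonious.
   Context: $\mathfrak{A}$ is a $C^*$-algebra and $\mathscr{H}$ is a (right) Hilbert $\mathfrak{A}$-module; $\mathcal{L}(\mathscr{H})$ is the $C^*$-algebra of adjointable operators on $\mathscr{H}$, and $I$ is the identity operator on $\mathscr{H}$. For $T\in\mathcal{L}(\mathscr{H})$, $\mathcal{R}(T)$ and $T^*$ denote its range and adjoint, and $|T|=(T^*T)^{1/2}$; the bar denotes norm closure. An idempotent is $Q\in\mathcal{L}(\mathscr{H})$ with $Q^2=Q$; a projection is a self-adjoint idempotent. A closed submodule $\mathscr{M}$ of $\mathscr{H}$ is orthogonally complemented in $\mathscr{H}$ if $\mathscr{H}=\mathscr{M}+\mathscr{M}^\perp$; then $P_{\mathscr{M}}$ denotes the projection from $\mathscr{H}$ onto $\mathscr{M}$. $T\in\mathcal{L}(\mathscr{H})$ has the polar decomposition if there is a partial isometry $U\in\mathcal{L}(\mathscr{H})$ with $T=U|T|$ and $U^*U=P_{\overline{\mathcal{R}(T^* )}}$ (in particular $\overline{\mathcal{R}(T^* )}$ is orthogonally complemented). A quasi-projection pair $(P,Q)$ on $\mathscr{H}$ consists of a projection $P\in\mathcal{L}(\mathscr{H})$ and an idempotent $Q\in\mathcal{L}(\mathscr{H})$ such that $PQ^*P=PQP$, $PQ^*(I-P)=-PQ(I-P)$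 and $(I-P)Q^*(I-P)=(I-P)Q(I-P)$; equivalently, $Q^*=(2P-I)Q(2P-I)$. It is known that if $(P,Q)$ is a quasi-projection pair, then so are $(I-P,I-Q)$, $(P,Q^* )$ and $(I-P,I-Q^* )$. A quasi-projection pair $(P,Q)$ is semi-harmonious if both $P(I-Q)$ and $(I-P)Q$ have the polar decomposition. *)

(* Defs.v *)
From HB Require Import structures.
From mathcomp Require Import all_boot all_order all_algebra.
From mathcomp Require Import complex.
From mathcomp Require Import all_classical all_reals all_analysis.

Set Implicit Arguments.
Unset Strict Implicit.
Unset Printing Implicit Defensive.

Import Order.TTheory GRing.Theory Num.Theory.
Import numFieldNormedType.Exports.

Local Open Scope classical_set_scope.
Local Open Scope ring_scope.

(** C*-algebras, not assumed unital; for this reason the product is not the one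
    of a MathComp ring.  The norm has values in [R[i]], as for every
    [normedModType] over [R[i]]. *)
HB.mixin Record isCStarAlgebra (R : realType) A
    of CompleteNormedModule R[i] A := {
  cmul : A -> A -> A;
  cstar : A -> A;
  cmulA : forall a b c, cmul a (cmul b c) = cmul (cmul a b) c;
  cmulDl : forall a b c, cmul (a + b) c = cmul a c + cmul b c;
  cmulDr : forall a b c, cmul a (b + c) = cmul a b + cmul a c;
  cmulZl : forall (k : R[i]) a b, cmul (k *: a) b = k *: cmul a b;
  cmulZr : forall (k : R[i]) a b, cmul a (k *: b) = k *: cmul a b;
  cnormM : forall a b, `|cmul a b| <= `|a| * `|b|;
  cstarK : forall a, cstar (cstar a) = a;
  cstarD : forall a b, cstar (a + b) = cstar a + cstar b;
  cstarZ : forall (k : R[i]) a, cstar (k *: a) = k^* *: cstar a;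
  cstarM : forall a b, cstar (cmul a b) = cmul (cstar b) (cstar a);
  cnorm_star : forall a, `|cmul (cstar a) a| = `|a| ^+ 2
}.

#[short(type="cstarAlgType")]
HB.structure Definition CStarAlgebra (R : realType) :=
  {A of CompleteNormedModule R[i] A & isCStarAlgebra R A}.

Definition cpositive (R : realType) (A : cstarAlgType R) (a : A) : Prop :=
  exists b : A, a = cmul (cstar b) b.

(** Right Hilbert modules; the inner product is linear in its second argument,
    and [hnormE] says that the ambient norm, for which the space is complete,
    is the one induced by the inner product. *)
HB.mixin Record isHilbertModule (R : realType) (A : cstarAlgType R) H
    of CompleteNormedModule R[i] H := {
  ract : H -> A -> H;
  inner : H -> H -> A;
  ractA : forall x a b, ract x (cmul a b) = ract (ract x a) b;
  ractDl : forall x y a, ract (x + y) a = ract x a + ract y a;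
  ractDr : forall x a b, ract x (a + b) = ract x a + ract x b;
  ractZl : forall (k : R[i]) x a, ract (k *: x) a = k *: ract x a;
  ractZr : forall (k : R[i]) x a, ract x (k *: a) = k *: ract x a;
  innerDr : forall x y z, inner x (y + z) = inner x y + inner x z;
  innerZr : forall (k : R[i]) x y, inner x (k *: y) = k *: inner x y;
  inner_ract : forall x y a, inner x (ract y a) = cmul (inner x y) a;
  innerC : forall x y, inner y x = cstar (inner x y);
  inner_pos : forall x, cpositive (inner x x);
  inner_eq0 : forall x, inner x x = 0 -> x = 0;
  hnormE : forall x, `|x| ^+ 2 = `|inner x x|
}.

#[short(type="hilbertModType")]
HB.structure Definition HilbertModule (R : realType) (A : cstarAlgType R) :=
  {H of CompleteNormedModule R[i] H & isHilbertModule R A H}.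

Definition is_adjoint (R : realType) (A : cstarAlgType R) (H : hilbertModType A)
    (T S : H -> H) : Prop :=
  forall x y, inner (T x) y = inner x (S y).

(** Linearity and boundedness are not required: they follow from the existence
    of an adjoint. *)
Record adjointable (R : realType) (A : cstarAlgType R) (H : hilbertModType A)
    : Type := Adjointable {
  adj_fun :> H -> H;
  adj_funP : exists S : H -> H, is_adjoint adj_fun S
}.

Notation "''L' ( H )" := (adjointable H)
  (at level 8, format "''L' ( H )") : type_scope.

Section AdjointableRing.
Context (R : realType) (A : cstarAlgType R) (H : hilbertModType A).
Implicit Types (x y z : H) (T S U : 'L(H)).

Lemma cstar0 : cstar (0 : A) = 0.
Proof. by apply: (addrI (cstar (0 : A))); rewrite -cstarD !addr0. Qed.

Lemma cstarN (a : A) : cstar (- a) = - cstar a.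
Proof. by apply: (addrI (cstar a)); rewrite -cstarD !subrr cstar0. Qed.

Lemma inner0r x : inner x (0 : H) = 0.
Proof. by apply: (addrI (inner x 0)); rewrite -innerDr !addr0. Qed.

Lemma innerNr x y : inner x (- y) = - inner x y.
Proof. by apply: (addrI (inner x y)); rewrite -innerDr !subrr inner0r. Qed.

Lemma inner0l x : inner (0 : H) x = 0.
Proof. by rewrite innerC inner0r cstar0. Qed.

Lemma innerDl x y z : inner (x + y) z = inner x z + inner y z.
Proof. by rewrite innerC innerDr cstarD -!innerC. Qed.

Lemma innerNl x y : inner (- x) y = - inner x y.
Proof. by rewrite innerC innerNr cstarN -innerC. Qed.

Lemma inner_ext x y : (forall z, inner z x = inner z y) -> x = y.
Proof.
move=> xy; apply/eqP; rewrite -subr_eq0; apply/eqP; apply: inner_eq0.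
by rewrite innerDr innerNr xy subrr.
Qed.

Lemma adjointableP T S : (forall x, T x = S x) -> T = S.
Proof.
case: T S => [t tP] [s sP] /= /funext ts; subst s.
by congr Adjointable; exact: Prop_irrelevance.
Qed.

Definition adj_choice T : H -> H := sval (cid (adj_funP T)).

Lemma adj_choiceP T x y : inner (T x) y = inner x (adj_choice T y).
Proof. exact: (svalP (cid (adj_funP T))). Qed.

Lemma adjoint_subproof T : exists S : H -> H, is_adjoint (adj_choice T) S.
Proof.
exists T => x y; rewrite innerC.
by rewrite -adj_choiceP -innerC.
Qed.

Definition adjoint T : 'L(H) := Adjointable (adjoint_subproof T).

Lemma adjointP T x y : inner (T x) y = inner x (adjoint T y).
Proof. exact: adj_choiceP. Qed.

Lemma adj_funD T x y : T (x + y) = T x + T y.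
Proof.
apply: inner_ext => z.
by rewrite innerDr !(innerC _ z) !adjointP innerDl cstarD.
Qed.

Lemma adj_zero_subproof : exists S : H -> H, is_adjoint (fun=> 0) S.
Proof. by exists (fun=> 0) => x y; rewrite inner0l inner0r. Qed.

Lemma adj_one_subproof : exists S : H -> H, is_adjoint id S.
Proof. by exists id. Qed.

Lemma adj_opp_subproof T : exists S : H -> H, is_adjoint (fun x => - T x) S.
Proof.
by exists (fun x => - adjoint T x) => x y; rewrite innerNl innerNr adjointP.
Qed.

Lemma adj_add_subproof T S :
  exists U : H -> H, is_adjoint (fun x => T x + S x) U.
Proof.
exists (fun x => adjoint T x + adjoint S x) => x y.
by rewrite innerDl innerDr !adjointP.
Qed.

Lemma adj_mul_subproof T S : exists U : H -> H, is_adjoint (T \o S) U.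
Proof. by exists (adjoint S \o adjoint T) => x y /=; rewrite !adjointP. Qed.

Definition adj_zero : 'L(H) := Adjointable adj_zero_subproof.
Definition adj_one : 'L(H) := Adjointable adj_one_subproof.
Definition adj_opp T : 'L(H) := Adjointable (adj_opp_subproof T).
Definition adj_add T S : 'L(H) := Adjointable (adj_add_subproof T S).
Definition adj_mul T S : 'L(H) := Adjointable (adj_mul_subproof T S).

HB.instance Definition _ := gen_eqMixin 'L(H).
HB.instance Definition _ := gen_choiceMixin 'L(H).

Lemma adj_addA : associative adj_add.
Proof. by move=> T S U; apply: adjointableP => x /=; rewrite addrA. Qed.
Lemma adj_addC : commutative adj_add.
Proof. by move=> T S; apply: adjointableP => x /=; rewrite addrC. Qed.
Lemma adj_add0 : left_id adj_zero adj_add.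
Proof. by move=> T; apply: adjointableP => x /=; rewrite add0r. Qed.
Lemma adj_addN : left_inverse adj_zero adj_opp adj_add.
Proof. by move=> T; apply: adjointableP => x /=; rewrite addNr. Qed.

HB.instance Definition _ :=
  GRing.isZmodule.Build 'L(H) adj_addA adj_addC adj_add0 adj_addN.

Lemma adj_mulA : associative adj_mul.
Proof. by move=> T S U; apply: adjointableP. Qed.
Lemma adj_mul1l : left_id adj_one adj_mul.
Proof. by move=> T; apply: adjointableP. Qed.
Lemma adj_mul1r : right_id adj_one adj_mul.
Proof. by move=> T; apply: adjointableP. Qed.
Lemma adj_mulDl : left_distributive adj_mul +%R.
Proof. by move=> T S U; apply: adjointableP. Qed.
Lemma adj_mulDr : right_distributive adj_mul +%R.
Proof. by move=> T S U; apply: adjointableP => x /=; rewrite adj_funD. Qed.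

(** [H] may be the zero module, so that [1 = 0] is not excluded. *)
HB.instance Definition _ := GRing.Zmodule_isPzRing.Build 'L(H)
  adj_mulA adj_mul1l adj_mul1r adj_mulDl adj_mulDr.

End AdjointableRing.

Notation "T ^†" := (adjoint T) (at level 2, format "T ^†") : ring_scope.

Section Operators.
Context (R : realType) (A : cstarAlgType R) (H : hilbertModType A).
Implicit Types (P Q T S U : 'L(H)) (M : set H).

Definition is_idempotent Q : Prop := Q * Q = Q.

Definition is_projection P : Prop := P * P = P /\ P^† = P.

(** Positivity in the C*-algebra ['L(H)]. *)
Definition op_positive S : Prop := exists B : 'L(H), S = B^† * B.

(** [S] is [|T|], the (unique) positive square root of [T^† * T]. *)
Definition is_modulus T S : Prop := op_positive S /\ S * S = T^† * T.

Definition is_partial_isometry U : Prop := is_projection (U^† * U).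

Definition closed_submodule M : Prop :=
  [/\ closed M, M 0,
      forall x y, M x -> M y -> M (x + y),
      forall (k : R[i]) x, M x -> M (k *: x) &
      forall x (a : A), M x -> M (ract x a)].

Definition orthogonal M : set H := [set x | forall y, M y -> inner y x = 0].

Definition orthogonally_complemented M : Prop :=
  closed_submodule M /\
  forall x, exists y z, [/\ M y, orthogonal M z & x = y + z].

(** [P] is the projection from [H] onto [M], for [M] orthogonally
    complemented. *)
Definition is_projection_onto M P : Prop :=
  [/\ orthogonally_complemented M, is_projection P & range P = M].

Definition has_polar_decomposition T : Prop :=
  exists U S, [/\ is_partial_isometry U, is_modulus T S, T = U * S &
                  is_projection_onto (closure (range T^†)) (U^† * U)].

Definition quasi_projection_pair P Q : Prop :=
  [/\ is_projection P, is_idempotent Q,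
      P * Q^† * P = P * Q * P,
      P * Q^† * (1 - P) = - (P * Q * (1 - P)) &
      (1 - P) * Q^† * (1 - P) = (1 - P) * Q * (1 - P)].

Definition semi_harmonious P Q : Prop :=
  [/\ quasi_projection_pair P Q,
      has_polar_decomposition (P * (1 - Q)) &
      has_polar_decomposition ((1 - P) * Q)].

End Operators.

(* Main.v *)
Require Import Defs.
From mathcomp Require Import all_boot all_order all_algebra.
From mathcomp Require Import complex.
From mathcomp Require Import all_classical all_reals all_analysis.

Set Implicit Arguments.
Unset Strict Implicit.
Unset Printing Implicit Defensive.

Import Order.TTheory GRing.Theory Num.Theory.
Import numFieldNormedType.Exports.

Local Open Scope classical_set_scope.
Local Open Scope ring_scope.

(** A quasi-projection pair satisfies [Q^† = J * Q * J], where [J := 2 P - 1] is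
    the symmetry (self-adjoint unitary) that is the identity on the range of [P]
    and minus the identity on the range of [1 - P]
    ([quasi_projection_pairP]).  Since [(1 - P) * J = - (1 - P)], this gives
    [(1 - P) * Q^† = ((1 - P) * Q) * (- J)], and likewise
    [P * (1 - Q^†) = (P * (1 - Q)) * J], which is the same identity for the pair
    [(1 - P, 1 - Q)], whose symmetry is [- J].  So passing from [Q] to [Q^†]
    only multiplies the two operators of interest by unitaries on the right.

    Right multiplication by a unitary [V] preserves polar decompositions
    ([has_polar_decompositionMr]): if [T = U |T|], then
    [T V = (U V) (V^† |T| V)], where [V^† |T| V] is the modulus of [T V], and
    [(U V)^† (U V) = V^† (U^† U) V] projects onto the image under [V^†] of the
    closure of the range of [T^†].  As [V^†] is an isometric bijection, that
    image is the closure of the range of [(T V)^†].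

    Passing from [(P, Q)] to [(1 - P, 1 - Q)] merely exchanges the two
    operators.  Both passages are involutive, and together they connect the
    four pairs. *)

(** * Adjoints and module-linearity *)

Section Adjoints.
Context (R : realType) (A : cstarAlgType R) (H : hilbertModType A).
Implicit Types (x y : H) (P Q T S U V : 'L(H)).

Lemma mulLE T S x : (T * S) x = T (S x).
Proof. by []. Qed.

Lemma adjoint_uniq T S : is_adjoint T S -> T^† = S.
Proof.
move=> TS; apply: adjointableP => y; apply: inner_ext => x.
by rewrite -adjointP TS.
Qed.

Lemma adjointK T : T^†^† = T.
Proof. by apply: adjoint_uniq => x y; rewrite innerC -adjointP -innerC. Qed.

Lemma adjointM T S : (T * S)^† = S^† * T^†.
Proof. by apply: adjoint_uniq => x y; rewrite !mulLE !adjointP. Qed.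

Lemma adjoint1 : (1 : 'L(H))^† = 1.
Proof. exact: adjoint_uniq. Qed.

Lemma adjointN T : (- T)^† = - T^†.
Proof.
by apply: adjoint_uniq => x y; rewrite /= innerNl innerNr adjointP.
Qed.

Lemma adjointD T S : (T + S)^† = T^† + S^†.
Proof.
by apply: adjoint_uniq => x y; rewrite /= innerDl innerDr !adjointP.
Qed.

Lemma adjointB T S : (T - S)^† = T^† - S^†.
Proof. by rewrite adjointD adjointN. Qed.

Lemma adjointPr T x y : inner x (T y) = inner (T^† x) y.
Proof. by rewrite adjointP adjointK. Qed.

Lemma adj_funN T x : T (- x) = - T x.
Proof. by apply: inner_ext => z; rewrite adjointPr !innerNr adjointPr. Qed.

Lemma adj_funZ T k x : T (k *: x) = k *: T x.
Proof. by apply: inner_ext => z; rewrite adjointPr !innerZr adjointPr. Qed.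

Lemma adj_fun_ract T x a : T (ract x a) = ract (T x) a.
Proof. by apply: inner_ext => z; rewrite adjointPr !inner_ract adjointPr. Qed.

End Adjoints.

(** * Polar decompositions and right multiplication by unitaries *)

Section Unitaries.
Context (R : realType) (A : cstarAlgType R) (H : hilbertModType A).
Implicit Types (x y : H) (P Q T S U V : 'L(H)) (M : set H).

Definition is_unitary V : Prop := V^† * V = 1 /\ V * V^† = 1.

Lemma unitary_adjoint V : is_unitary V -> is_unitary V^†.
Proof. by case=> VsV VVs; split; rewrite adjointK. Qed.

Lemma unitaryN V : is_unitary V -> is_unitary (- V).
Proof. by case=> VsV VVs; split; rewrite adjointN mulrNN. Qed.

Lemma unitaryK V : is_unitary V -> cancel V V^†.
Proof. by case=> VsV _ x; rewrite -mulLE VsV. Qed.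

Lemma unitary_norm V x : is_unitary V -> `|V x| = `|x|.
Proof.
move=> uV; apply/eqP; rewrite -(@eqrXn2 _ 2) ?normr_ge0 //.
by rewrite !hnormE adjointP unitaryK.
Qed.

Lemma unitary_continuous V : is_unitary V -> continuous V.
Proof.
move=> uV x; apply/cvgrPdist_lt => e e0.
have near_x : \forall t \near x, `|x - t| < e.
  exact: (cvgr_dist_lt id x (@cvg_id _ (nbhs x))).
by apply: filterS near_x => t; rewrite -adj_funN -adj_funD unitary_norm.
Qed.

Lemma unitary_image_closure_sub V M :
  is_unitary V -> V @` closure M `<=` closure (V @` M).
Proof.
move=> uV _ [x Mx <-] B /(unitary_continuous uV) BV.
by have [y [My By]] := Mx _ BV; exists (V y); split => //; exists y.
Qed.

(** Both [V] and its inverse [V^†] are isometries, so that [V] is a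
    homeomorphism. *)
Lemma unitary_image_closure V M :
  is_unitary V -> closure (V @` M) = V @` closure M.
Proof.
move=> uV; have uVs := unitary_adjoint uV.
have VK : cancel V^† V by have := unitaryK uVs; rewrite adjointK.
apply/seteqP; split; last exact: unitary_image_closure_sub.
move=> y yVM; exists (V^† y) => //.
have := unitary_image_closure_sub (M := V @` M) uVs.
rewrite image_comp (_ : V^† \o V = id) ?image_id; last first.
  by apply/funext => x; exact: unitaryK.
by apply; exists y.
Qed.

Lemma projection_orthogonally_complemented P :
  is_projection P -> closed (range P) -> orthogonally_complemented (range P).
Proof.
move=> [PP Ps] Pcl; split.
  split => //.
  - by exists 0 => //; rewrite -[0 in LHS](subrr 0) adj_funD adj_funN subrr.
  - by move=> _ _ [x _ <-] [y _ <-]; exists (x + y); rewrite ?adj_funD.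
  - by move=> k _ [x _ <-]; exists (k *: x); rewrite ?adj_funZ.
  - by move=> _ a [x _ <-]; exists (ract x a); rewrite ?adj_fun_ract.
move=> x; exists (P x), (x - P x); split; first by exists x.
  move=> _ [y _ <-].
  by rewrite adjointP Ps adj_funD adj_funN -mulLE PP subrr inner0r.
by rewrite addrC subrK.
Qed.

(** The polar decomposition of [T * V] is obtained by conjugating that of [T]:
    the partial isometry becomes [U * V] and the modulus [V^† * S * V]. *)
Lemma has_polar_decompositionMr T V :
  is_unitary V -> has_polar_decomposition T -> has_polar_decomposition (T * V).
Proof.
move=> uV [U [S [[UU Us] [[B SB] SS] TUS [_ _ UT]]]].
have [VsV VVs] := uV; have uVs := unitary_adjoint uV.
have VVsK X : V * (V^† * X) = X by rewrite mulrA VVs mul1r.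
have UVE : (U * V)^† * (U * V) = V^† * (U^† * U) * V.
  by rewrite adjointM !mulrA.
have pUV : is_projection ((U * V)^† * (U * V)).
  split; last by rewrite adjointM adjointK.
  by rewrite UVE -!mulrA VVsK [in RHS](mulrA U^†) -[in RHS]UU -!mulrA.
have rUV : range ((U * V)^† * (U * V)) = closure (range (T * V)^†).
  rewrite (adjointM T) (_ : range (V^† * T^†) = V^† @` range T^†); last first.
    by rewrite image_comp.
  rewrite unitary_image_closure // -UT UVE.
  apply/seteqP; split => [_ [x _ <-]|_ [_ [z _ <-] <-]].
    by exists ((U^† * U) (V x)) => //; exists (V x).
  by exists (V^† z); rewrite // -!mulLE -!mulrA VVs mulr1.
exists (U * V), (V^† * S * V); split => //.
- split; first by exists (B * V); rewrite SB adjointM !mulrA.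
  by rewrite adjointM -!mulrA VVsK (mulrA S) SS TUS -!mulrA.
- by rewrite -!mulrA VVsK mulrA -TUS.
- rewrite -rUV; split => //.
  apply: projection_orthogonally_complemented => //.
  by rewrite rUV; exact: closed_closure.
Qed.

End Unitaries.

(** * The symmetry of a quasi-projection pair *)

Section QuasiProjectionPairs.
Context (R : realType) (A : cstarAlgType R) (H : hilbertModType A).
Implicit Types (P Q : 'L(H)).

(** This is [2 P - 1]; written as a difference of complementary projections, its
    products with [P] and [1 - P] are immediate. *)
Definition symmetry P : 'L(H) := P - (1 - P).

Lemma symmetryC P : symmetry (1 - P) = - symmetry P.
Proof. by rewrite /symmetry subKr opprB. Qed.

Lemma symmetry_adjoint P : is_projection P -> (symmetry P)^† = symmetry P.
Proof. by move=> [_ Ps]; rewrite !adjointB adjoint1 Ps. Qed.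

Lemma mulr_symmetry P : is_projection P -> P * symmetry P = P.
Proof. by move=> [PP _]; rewrite !mulrBr mulr1 PP subrr subr0. Qed.

Lemma mul_symmetryr P : is_projection P -> symmetry P * P = P.
Proof. by move=> [PP _]; rewrite !mulrBl mul1r PP subrr subr0. Qed.

Lemma projectionC P : is_projection P -> is_projection (1 - P).
Proof.
move=> [PP Ps]; split; last by rewrite adjointB adjoint1 Ps.
by rewrite mulrBl mul1r mulrBr mulr1 PP subrr subr0.
Qed.

Lemma idempotentC Q : is_idempotent Q -> is_idempotent (1 - Q).
Proof.
rewrite /is_idempotent => QQ.
by rewrite mulrBl mul1r mulrBr mulr1 QQ subrr subr0.
Qed.

Lemma mulrC_symmetry P :
  is_projection P -> (1 - P) * symmetry P = - (1 - P).
Proof.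
move=> /projectionC/mulr_symmetry; rewrite symmetryC mulrN => {2}<-.
by rewrite opprK.
Qed.

Lemma mul_symmetryrC P :
  is_projection P -> symmetry P * (1 - P) = - (1 - P).
Proof.
move=> /projectionC/mul_symmetryr; rewrite symmetryC mulNr => {2}<-.
by rewrite opprK.
Qed.

Lemma symmetry2 P : is_projection P -> symmetry P * symmetry P = 1.
Proof.
move=> pP; rewrite {1}/symmetry mulrBl mulr_symmetry // mulrC_symmetry //.
by rewrite opprK addrC subrK.
Qed.

Lemma symmetry_unitary P : is_projection P -> is_unitary (symmetry P).
Proof. by move=> pP; split; rewrite symmetry_adjoint // symmetry2. Qed.

(** In the decomposition of [H] by [P], conjugation by the symmetry keeps the
    diagonal blocks of an operator and negates the off-diagonal ones; these are
    the relations that define the pair. *)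
Lemma quasi_projection_pairP P Q :
  quasi_projection_pair P Q <->
  [/\ is_projection P, is_idempotent Q & Q^† = symmetry P * Q * symmetry P].
Proof.
split=> [[pP QQ E1 E2 E3]|[pP QQ E]]; split => //.
- have [_ Ps] := pP; have [_ PCs] := projectionC pP.
  (* The fourth block, implicit in the definition, is the adjoint of the
     second. *)
  have E4 : (1 - P) * Q^† * P = - ((1 - P) * Q * P).
    have := congr1 (@adjoint _ _ _) E2.
    rewrite adjointN !adjointM adjointK PCs Ps !mulrA => ->.
    by rewrite opprK.
  have blocks X : X = P * X * P + P * X * (1 - P)
                      + ((1 - P) * X * P + (1 - P) * X * (1 - P)).
    by rewrite -!mulrDr subrKC !mulr1 -mulrDl subrKC mul1r.
  rewrite [LHS]blocks [RHS]blocks E1 E2 E3 E4 !mulrA.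
  rewrite mulr_symmetry // mulrC_symmetry // -!(mulrA _ (symmetry P)).
  by rewrite mul_symmetryr // mul_symmetryrC // !mulNr !mulrN opprK.
- by rewrite E !mulrA mulr_symmetry // -!mulrA mul_symmetryr.
- by rewrite E !mulrA mulr_symmetry // -!mulrA mul_symmetryrC // !mulrN.
- by rewrite E !mulrA mulrC_symmetry // -!mulrA mul_symmetryrC //
    mulNr !mulrN opprK.
Qed.

Lemma quasi_projection_pairC P Q :
  quasi_projection_pair P Q -> quasi_projection_pair (1 - P) (1 - Q).
Proof.
move=> /quasi_projection_pairP[pP QQ E]; apply/quasi_projection_pairP.
split; [exact: projectionC | exact: idempotentC |].
rewrite symmetryC mulrN !mulNr opprK adjointB adjoint1 E.
by rewrite (mulrBr _ 1 Q) mulr1 (mulrBl _ (symmetry P) (symmetry P * Q))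
  symmetry2.
Qed.

Lemma quasi_projection_pair_adjoint P Q :
  quasi_projection_pair P Q -> quasi_projection_pair P Q^†.
Proof.
move=> /quasi_projection_pairP[pP QQ E]; apply/quasi_projection_pairP.
split => //; first by rewrite /is_idempotent -adjointM QQ.
by rewrite adjointK E !mulrA symmetry2 // mul1r -mulrA symmetry2 // mulr1.
Qed.

Lemma semi_harmoniousC P Q :
  semi_harmonious P Q -> semi_harmonious (1 - P) (1 - Q).
Proof.
by move=> [qPQ pd1 pd2]; split; rewrite ?subKr //; exact: quasi_projection_pairC.
Qed.

(** Applied to [(1 - P, 1 - Q)], this also covers the other operator,
    [P * (1 - Q)]. *)
Lemma has_polar_decomposition_mul_adjoint P Q :
  quasi_projection_pair P Q -> has_polar_decomposition ((1 - P) * Q) ->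
  has_polar_decomposition ((1 - P) * Q^†).
Proof.
move=> /quasi_projection_pairP[pP _ E] pd.
rewrite (_ : (1 - P) * Q^† = (1 - P) * Q * - symmetry P).
  by apply: has_polar_decompositionMr => //; exact/unitaryN/symmetry_unitary.
by rewrite E !mulrA mulrC_symmetry // !mulNr mulrN.
Qed.

Lemma semi_harmonious_adjoint P Q :
  semi_harmonious P Q -> semi_harmonious P Q^†.
Proof.
move=> [qPQ pd1 pd2]; split; first exact: quasi_projection_pair_adjoint.
  have := has_polar_decomposition_mul_adjoint (quasi_projection_pairC qPQ).
  by rewrite subKr adjointB adjoint1; apply.
exact: has_polar_decomposition_mul_adjoint.
Qed.

End QuasiProjectionPairs.

Theorem corollary3p7 (R : realType) (A : cstarAlgType R) (H : hilbertModType A)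
    (P Q : 'L(H)) :
  quasi_projection_pair P Q ->
  semi_harmonious P Q \/ semi_harmonious (1 - P) (1 - Q) \/
    semi_harmonious P Q^† \/ semi_harmonious (1 - P) (1 - Q^†) ->
  [/\ semi_harmonious P Q, semi_harmonious (1 - P) (1 - Q),
      semi_harmonious P Q^† & semi_harmonious (1 - P) (1 - Q^†)].
Proof.
move=> _ one.
have sPQ : semi_harmonious P Q.
  case: one => [|[|[|]]] //.
  - by move=> /semi_harmoniousC; rewrite !subKr.
  - by move=> /semi_harmonious_adjoint; rewrite adjointK.
  - by move=> /semi_harmoniousC/semi_harmonious_adjoint; rewrite !subKr adjointK.
split => //; first exact: semi_harmoniousC.
  exact: semi_harmonious_adjoint.
exact/semi_harmoniousC/semi_harmonious_adjoint.
Qed.
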